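(* Let $\lambda=(\lambda_n)_{n\in\mathbb{N}}$ be a sequence of non-zero complex numbers such that $\lambda_n\to\infty$, let $\theta\in(0,1)$, and let $G:\mathbb{C}\to\mathbb{C}$ be an entire function which is not constant. Then $\mathcal{U}(\lambda,\theta,G)=\emptyset$.
   Context: $\mathcal{H}(\mathbb{C})$ denotes the set of entire functions, and $\lambda_n\to\infty$ means $|\lambda_n|\to+\infty$. For a sequence $\lambda=(\lambda_n)_{n\in\mathbb{N}}$ of complex numbers, a positive number $\theta$ and $G\in\mathcal{H}(\mathbb{C})$, the set $\mathcal{U}(\lambda,\theta,G)$ consists of all $f\in\mathcal{H}(\mathbb{C})$ for which there exists a sequence $m=(m_n)_{n\in\mathbb{N}}$, with $m_n\in\{\lambda_k : k\in\mathbb{N}\}$ for every $n\in\mathbb{N}$, such that for every compact set $L\subseteq\mathbb{C}$, $$\sup_{(t,z)\in[0,\theta]\times L}\left|f(z+m_ne^{2\pi i t})-G(z)\right|\to 0\quad\text{as } n\to+\infty.$$ *)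

(* Defs.v *)
From HB Require Import structures.
From mathcomp Require Import all_boot all_order all_algebra.
From mathcomp Require Import complex.
From mathcomp Require Import all_classical all_reals all_analysis.

Set Implicit Arguments.
Unset Strict Implicit.
Unset Printing Implicit Defensive.

Import Order.TTheory GRing.Theory Num.Theory.
Import numFieldNormedType.Exports.

Local Open Scope classical_set_scope.
Local Open Scope ring_scope.
Local Open Scope complex_scope.

(* The regular module [R[i]^o] is the copy of [R[i]] on which the library puts
   the topology of the modulus and the structure of a normed module over
   [R[i]]; in particular [derivable] on it is complex differentiability. *)
Notation Cplx R := (R[i]^o) (only parsing).

(* The library norm on [R[i]] takes its values in [R[i]]; this one is real. *)
Definition cmod (R : realType) (z : R[i]) : R := ComplexField.Normc.normc z.

Definition entire (R : realType) (f : Cplx R -> Cplx R) : Prop :=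
  forall z : Cplx R, derivable f z 1.

(* [e^{2 pi i t}], by Euler's formula. *)
Definition expi2pi (R : realType) (t : R) : R[i] :=
  cos (2 * pi * t) +i* sin (2 * pi * t).

(* [L] is required to be nonempty because the supremum of the empty set is
   [-oo] in [\bar R]; for [L] empty there is nothing to ask. *)
Definition U_set (R : realType) (lambda : nat -> Cplx R) (theta : R)
    (G : Cplx R -> Cplx R) : set (Cplx R -> Cplx R) :=
  [set f | entire f /\
    exists m : nat -> Cplx R,
      (forall n, range lambda (m n)) /\
      forall L : set (Cplx R), compact L -> L !=set0 ->
        ereal_sup [set (cmod (f (tz.2 + m n * expi2pi tz.1) - G tz.2))%:E
                  | tz in `[0, theta] `*` L] @[n --> \oo] --> 0%E].

(* Main.v *)
(* Since the [lambda n] are nonzero and tend to infinity, [|m n| >= c > 0].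
   For small [d > 0] some [t] in [[0, theta]] makes the chord
   [h = m n (e^{2 pi i t} - 1)] have modulus exactly [d]. As
   [(h + z) + m n = z + m n e^{2 pi i t}], the value of [f] at this point is
   close both to [G (h + z)] and to [G z]. So [G] has approximate periods of
   every small modulus [d]; comparing with [G (h + z) - G z = h G'(z) + o(h)]
   gives [G' = 0], and [G] is constant. *)
Require Import Defs.
From HB Require Import structures.
From mathcomp Require Import all_boot all_order all_algebra.
From mathcomp Require Import complex ring lra.
From mathcomp Require Import all_classical all_reals all_analysis.

Import Order.TTheory GRing.Theory Num.Theory.
Import numFieldNormedType.Exports.

Local Open Scope classical_set_scope.
Local Open Scope ring_scope.
Local Open Scope complex_scope.

Section ComplexPlane.
Local Set Implicit Arguments.
Local Unset Strict Implicit.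
Variable R : realType.
Implicit Types z w : R[i].

(** * The real-valued modulus and compact squares in the plane *)

Lemma normE_cmod z : `|z| = (cmod z)%:C.
Proof. by []. Qed.

Lemma cmodD z w : cmod (z + w) <= cmod z + cmod w.
Proof. exact: le_normcD. Qed.

Lemma cmodN z : cmod (- z) = cmod z.
Proof. exact: normcN. Qed.

Lemma cmodM z w : cmod (z * w) = cmod z * cmod w.
Proof. exact: ComplexField.Normc.normcM. Qed.

Lemma cmod_ge0 z : 0 <= cmod z.
Proof. by case: z => a b; exact: sqrtr_ge0. Qed.

Lemma cmod0 : cmod (0 : R[i]) = 0.
Proof. exact: ComplexField.Normc.normc0. Qed.

Lemma cmod_eq0 z : (cmod z == 0) = (z == 0).
Proof.
apply/eqP/eqP => [|->]; last exact: cmod0.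
exact: ComplexField.Normc.eq0_normc.
Qed.

Lemma cmod_gt0 z : (0 < cmod z) = (z != 0).
Proof. by rewrite lt_def cmod_ge0 andbT cmod_eq0. Qed.

Lemma cmod_real (x : R) : cmod x%:C = `|x|.
Proof. by rewrite /cmod /= expr0n /= addr0 sqrtr_sqr. Qed.

Lemma normRe_le_cmod z : `|complex.Re z| <= cmod z.
Proof. by rewrite -lecR -normE_cmod; exact: normc_ge_Re. Qed.

Lemma normIm_le_cmod z : `|complex.Im z| <= cmod z.
Proof.
case: z => a b; rewrite /cmod /= -(@sqrtr_sqr _ b) ler_wsqrtr// lerDr.
exact: sqr_ge0.
Qed.

Lemma cmod_le_normD (a b : R) : cmod (a +i* b) <= `|a| + `|b|.
Proof.
rewrite -(ler_pXn2r (n := 2%N))// ?nnegrE ?cmod_ge0 ?addr_ge0//.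
rewrite /cmod /= sqr_sqrtr ?addr_ge0 ?sqr_ge0// sqrrD !real_normK ?num_real//.
by rewrite lerD2r lerDl mulrn_wge0// mulr_ge0.
Qed.

Lemma continuous_complex : continuous (fun p : R * R => p.1 +i* p.2 : Cplx R).
Proof.
move=> -[x y]; apply/cvgrPdist_lt => -[e e'] /=.
(* A positive element of [R[i]] has zero imaginary part, so the tolerance is a real number. *)
rewrite ltcE /= => /andP[/eqP -> e0].
have e2 : 0 < e / 2 by rewrite divr_gt0.
have h1 : \forall p \near nbhs (x, y), `|x - p.1| < e / 2.
  exact: (@cvgr_dist_lt _ _ _ _ _ fst x cvg_fst _ e2).
have h2 : \forall p \near nbhs (x, y), `|y - p.2| < e / 2.
  exact: (@cvgr_dist_lt _ _ _ _ _ snd y cvg_snd _ e2).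
near=> p.
rewrite [X in X < _](_ : _ = (cmod ((x - p.1) +i* (y - p.2)))%:C)// ltcR.
rewrite (le_lt_trans (cmod_le_normD _ _))// (splitr e) ltrD//; near: p; assumption.
Unshelve. all: by end_near. Qed.

(** Serves as a compact set containing the closed disc of radius [d] about [z]; a square is a
    continuous image of a product of two segments. *)
Lemma compact_square (z : Cplx R) (d : R) :
  compact [set z + (p.1 +i* p.2) | p in `[- d, d] `*` `[- d, d]].
Proof.
apply: continuous_compact; last by apply: compact_setX; exact: segment_compact.
apply: continuous_subspaceT => p.
by apply: cvgD; [exact: cvg_cst|exact: continuous_complex].
Qed.

(** * Chords of the unit circle and a lower bound for the moduli *)

Lemma cmod_expi2piB1 (t : R) :
  cmod (expi2pi t - 1) ^+ 2 = 2 * (1 - cos (2 * pi * t)).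
Proof.
rewrite /expi2pi /cmod /= sqr_sqrtr ?addr_ge0 ?sqr_ge0//.
by rewrite subr0 sin2cos2; ring.
Qed.

(** The squared chord is [2 * (1 - cos (2 * pi * t))], so the intermediate value theorem for the
    cosine yields every small length. *)
Lemma small_chord (theta : R) : 0 < theta ->
  exists2 r0, 0 < r0 & forall r, 0 <= r <= r0 ->
    exists2 t, t \in `[0, theta] & cmod (expi2pi t - 1) = r.
Proof.
(* The cap [1 / 2] keeps the angle in [[0, pi]], where the cosine is injective; hence [k > 0]
   below. *)
move=> th0; set t0 := Num.min theta (1 / 2).
have t00 : 0 < t0 by rewrite /t0 lt_min th0/= divr_gt0.
have t01 : t0 <= 1 / 2 by rewrite /t0 ge_min lexx orbT.
have p0 := pi_gt0 R.
set k := 1 - cos (2 * pi * t0).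
have k0 : 0 < k.
  rewrite subr_gt0 lt_neqAle cos_le1 andbT; apply/eqP.
  rewrite -[X in _ = X](@cos0 R) => H.
  suff : 2 * pi * t0 = 0 by apply/eqP; rewrite !mulf_neq0// gt_eqF.
  by apply: (@cos_inj R _ _ _ _ H); rewrite in_itv/= ?lexx ?pi_ge0//; nra.
(* A chord of length [r] has cosine [1 - r ^+ 2 / 2]. From [r <= 1] and [r <= k] follows
   [r ^+ 2 / 2 <= k], so this value lies between [cos (2 * pi * t0) = 1 - k] and [1]. *)
exists (Num.min 1 k) => [|r /andP[r0 ]]; first by rewrite lt_min ltr01.
rewrite le_min => /andP[r1 rk].
have [|||t] := @IVT _ (fun t => cos (2 * pi * t)) 0 t0 (1 - r ^+ 2 / 2).
- exact: ltW.
- apply: continuous_subspaceT => x.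
  apply: (@continuous_comp _ _ _ (fun t => 2 * pi * t) (@cos R)).
    exact: mulrl_continuous.
  exact: continuous_cos.
- rewrite mulr0 cos0 ge_min le_max; apply/andP; split; apply/orP; [right|left].
    by rewrite -[cos _](subKr 1) -/k; nra.
  by nra.
rewrite !in_itv/= => /andP[t1 t2] ct; exists t.
  by rewrite in_itv/= t1 (le_trans t2)// /t0 ge_min lexx.
apply/eqP; rewrite -(@eqrXn2 _ 2%N)// ?cmod_ge0// cmod_expi2piB1 ct.
by apply/eqP; field.
Qed.

(** Beyond some [N] the moduli are at least 1; the finitely many earlier ones are positive, and
    induction on [N] takes their minimum. *)
Lemma cmod_lower_bound (u : nat -> R[i]) :
  (forall n, u n != 0) -> cmod (u n) @[n --> \oo] --> +oo ->
  exists2 c, 0 < c & forall n, c <= cmod (u n).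
Proof.
move=> u0 /cvgryPge/(_ 1)[N _ uN].
suff [c c0 uc] : exists2 c, 0 < c & forall n, (n < N)%N -> c <= cmod (u n).
  exists (Num.min 1 c) => [|n]; first by rewrite lt_min ltr01.
  rewrite ge_min; case: (ltnP n N) => [/uc ->|nN]; first by rewrite orbT.
  by rewrite (uN n nN).
elim: N {uN} => [|N [c c0 uc]]; first by exists 1.
exists (Num.min c (cmod (u N))) => [|n]; first by rewrite lt_min c0 cmod_gt0 u0.
rewrite ltnS leq_eqVlt ge_min => /predU1P[->|/uc -> //].
by rewrite lexx orbT.
Qed.

(** * First-order approximation and vanishing derivatives *)

Lemma derivable_approx (G : Cplx R -> Cplx R) z (e : R) :
  derivable G z 1 -> 0 < e ->
  exists2 r, 0 < r & forall h, cmod h < r ->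
    cmod (G (h + z) - G z - h * 'D_1 G z) <= e * cmod h.
Proof.
move=> dG e0.
have eC : 0 < e%:C :> R[i] by rewrite ltcR.
have /cvgrPdist_lt/(_ _ eC) := dG.
move=> /nbhs_ballP[/= [r r']]; rewrite ltcE /= => /andP[/eqP -> r0] H.
exists r => // h hr; have [->|h0] := eqVneq h 0.
  by rewrite add0r subrr mul0r subrr cmod0 mulr0.
have := H h; rewrite /ball /= sub0r normrN normE_cmod ltcR => /(_ hr h0).
rewrite -/('D_1 G z) => K.
have {}K : cmod ('D_1 G z - h^-1 * (G (h + z) - G z)) < e.
  by rewrite -ltcR -normE_cmod; move: K; rewrite /GRing.scale /= mulr1.
have -> : G (h + z) - G z - h * 'D_1 G z =
    - (h * ('D_1 G z - h^-1 * (G (h + z) - G z))).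
  by rewrite mulrBr mulVKf// opprB.
by rewrite cmodN cmodM mulrC ler_wpM2r ?cmod_ge0// ltW.
Qed.

(** Since [h] has modulus exactly [d], the bound on [h * 'D_1 G z] can be divided by [d]; [eta] may
    depend on [d]. *)
Lemma derive0_of_small_periods (G : Cplx R -> Cplx R) z (d0 : R) :
  derivable G z 1 -> 0 < d0 ->
  (forall d, 0 < d <= d0 -> forall eta, 0 < eta ->
     exists2 h, cmod h = d & cmod (G (h + z) - G z) < eta) ->
  'D_1 G z = 0.
Proof.
move=> dG d00 H; apply/eqP; rewrite -cmod_eq0 eq_le cmod_ge0 andbT.
apply/ler_addgt0Pr => e e0; rewrite add0r.
have e2 : 0 < e / 2 by rewrite divr_gt0.
have [r r0 Hr] := derivable_approx dG e2.
set d := Num.min d0 (r / 2).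
have d_gt0 : 0 < d by rewrite /d lt_min d00 divr_gt0.
have dr : d < r by rewrite /d gt_min ltr_pdivrMr// ltr_pMr// ltr1n orbT.
(* With this [eta], the increment of [G] and the linearization error are each at most
   [e / 2 * d]. *)
have [|h hd hG] := H d _ (e / 2 * d) (mulr_gt0 e2 d_gt0).
  by rewrite d_gt0 /d ge_min lexx.
have := Hr h; rewrite hd => /(_ dr) Hh.
rewrite -(ler_pM2r d_gt0) -{1}hd mulrC -cmodM.
have -> : h * 'D_1 G z = G (h + z) - G z - (G (h + z) - G z - h * 'D_1 G z).
  by rewrite subKr.
rewrite (le_trans (cmodD _ _))// cmodN.
rewrite [leRHS](_ : _ = e / 2 * d + e / 2 * d); last by rewrite -mulrDl -splitr.
by rewrite lerD// ltW.
Qed.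

Lemma is_derive0_of_small_o (u : R -> R) (t : R) :
  (forall e, 0 < e -> exists2 r, 0 < r & forall h, `|h| < r ->
     `|u (h + t) - u t| <= e * `|h|) -> is_derive t 1 u 0.
Proof.
move=> H.
have K : h^-1 *: (u (h *: 1 + t) - u t) @[h --> 0^'] --> (0 : R).
  apply/cvgrPdist_le => e e0; have [r r0 Hr] := H e e0.
  exists r => //= h; rewrite /ball_ /= sub0r normrN => hr h0.
  rewrite sub0r normrN /GRing.scale /= mulr1 normrM normfV mulrC.
  by rewrite ler_pdivrMr ?normr_gt0//; exact: Hr.
apply: DeriveDef; first by apply/cvg_ex; exists 0.
exact: (cvg_lim _ K).
Qed.

(** Along the real line [t |-> t%:C * z] the real and imaginary parts of [G] have zero derivative,
    hence agree at [t = 0] and [t = 1]. *)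
Lemma derive0_is_cst (G : Cplx R -> Cplx R) :
  entire G -> (forall z, 'D_1 G z = 0) -> forall z, G z = G 0.
Proof.
move=> dG dG0 z.
have small t e : 0 < e -> exists2 r, 0 < r & forall h : R, `|h| < r ->
    cmod (G ((h + t)%:C * z) - G (t%:C * z)) <= e * `|h|.
  (* Using [cmod z + 1] as the scaling factor permits division even when [z = 0]. *)
  move=> e0; have z1 : 0 < cmod z + 1 by rewrite ltr_wpDl ?cmod_ge0.
  have ez : 0 < e / (cmod z + 1) by rewrite divr_gt0.
  have [r r0 Hr] := derivable_approx (dG (t%:C * z)) ez.
  exists (r / (cmod z + 1)) => [|h]; first by rewrite divr_gt0.
  rewrite ltr_pdivlMr// => hr.
  have hz : cmod (h%:C * z) <= `|h| * (cmod z + 1).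
    by rewrite cmodM cmod_real ler_wpM2l// lerDl.
  have := Hr (h%:C * z) (le_lt_trans hz hr).
  rewrite dG0 mulr0 subr0 rmorphD mulrDl => /le_trans; apply.
  by rewrite mulrAC ler_pdivrMr// -mulrA ler_wpM2l// ltW.
have Re_cst : complex.Re (G (1%:C * z)) = complex.Re (G (0%:C * z)).
  apply: (@is_derive_0_is_cst R (fun t => complex.Re (G (t%:C * z)))) => t.
  apply: is_derive0_of_small_o => e /(small t)[r r0 Hr].
  exists r => // h /Hr; apply: le_trans.
  by rewrite -raddfB; exact: normRe_le_cmod.
have Im_cst : complex.Im (G (1%:C * z)) = complex.Im (G (0%:C * z)).
  apply: (@is_derive_0_is_cst R (fun t => complex.Im (G (t%:C * z)))) => t.
  apply: is_derive0_of_small_o => e /(small t)[r r0 Hr].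
  exists r => // h /Hr; apply: le_trans.
  by rewrite -raddfB; exact: normIm_le_cmod.
rewrite -[z in LHS]mul1r -[in RHS](mul0r z).
by apply/eqP; rewrite eq_complex; apply/andP; split; apply/eqP.
Qed.

End ComplexPlane.

Theorem theorem4p2 (R : realType) (lambda : nat -> Cplx R) (theta : R)
    (G : Cplx R -> Cplx R)
    (lambda_neq0 : forall n, lambda n != 0)
    (lambda_oo : cmod (lambda n) @[n --> \oo] --> +oo)
    (theta_in01 : 0 < theta < 1)
    (G_entire : entire G)
    (G_nonconst : ~ (exists c, forall z, G z = c)) :
  U_set lambda theta G = set0.
Proof.
rewrite -subset0 => f [_ [m [mlambda mG]]]; apply: G_nonconst.
exists (G 0); apply: derive0_is_cst => // z.
have /andP[th0 _] := theta_in01.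
have [c c0 lambdac] := cmod_lower_bound lambda_neq0 lambda_oo.
have [r0 r00 chord] := small_chord th0.
(* As [c <= cmod (m n)], any [d <= c * r0] satisfies [d / cmod (m n) <= r0], whatever [n] is. *)
apply: (@derive0_of_small_periods _ _ _ (c * r0)) => //; first exact: mulr_gt0.
move=> d /andP[d0 dr] eta eta0.
(* The shift [h] will depend on [n], which is chosen after [L]; so [L] must contain [h + z] for all
   [h] of modulus at most [d]. *)
set L := [set z + (p.1 +i* p.2) | p in `[- d, d] `*` `[- d, d]].
have inL h : cmod h <= d -> L (h + z).
  case: h => a b hd; exists (a, b); last by rewrite addrC.
  by split; rewrite /= in_itv/= -ler_norml (le_trans _ hd)//;
    [exact: (normRe_le_cmod (a +i* b))|exact: (normIm_le_cmod (a +i* b))].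
have Lz : L z by rewrite -[z]add0r; apply: inL; rewrite cmod0 ltW.
have /(_ (ex_intro _ z Lz)) := mG L (@compact_square R z d).
have eta2 : 0 < eta / 2 by rewrite divr_gt0.
(* Convergence to [0] in the extended reals makes the supremum eventually finite and below
   [eta / 2]; a single such [n] suffices. *)
move=> /fine_cvgP[fin /cvgr0Pnorm_lt/(_ _ eta2) small].
have [n [/= fin_n small_n]] := filter_ex (filterI fin small).
have close t w : t \in `[0, theta] -> L w ->
    cmod (f (w + m n * expi2pi t) - G w) < eta / 2.
  move=> tth Lw; apply: le_lt_trans (le_lt_trans (ler_norm _) small_n).
  rewrite -lee_fin fineK//; apply: ereal_sup_ubound.
  by exists (t, w).
have [k _ mk] := mlambda n.
have mn : c <= cmod (m n) by rewrite -mk.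
have mn0 : 0 < cmod (m n) by exact: lt_le_trans mn.
have [|t tth tE] := chord (d / cmod (m n)).
  rewrite divr_ge0 ?cmod_ge0 ?(ltW d0)//= ler_pdivrMr// (le_trans dr)//.
  by rewrite mulrC ler_wpM2l// ltW.
set h := m n * (expi2pi t - 1).
have hd : cmod h = d by rewrite cmodM tE mulrC divfK// gt_eqF.
exists h => //.
have t0 : 0 \in `[0, theta] by rewrite in_itv/= lexx ltW.
have near_shift := close 0 (h + z) t0 (inL h _).
have near_rot := close t z tth Lz.
have same : h + z + m n * expi2pi 0 = z + m n * expi2pi t.
  have -> : expi2pi (0 : R) = 1 by rewrite /expi2pi mulr0 cos0 sin0.
  by rewrite /h mulrBr mulr1 addrAC subrK addrC.
rewrite same hd lexx in near_shift.
have -> : G (h + z) - G z = (f (z + m n * expi2pi t) - G z)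
    - (f (z + m n * expi2pi t) - G (h + z)).
  by rewrite opprB [RHS]addrC addrA subrK.
rewrite (le_lt_trans (cmodD _ _))// cmodN (splitr eta) ltrD//.
exact: near_shift.
Qed.
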